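(* Let $Sp(K,S)$ be a split graph with biadjacency matrix $R$. Then: (1) $(x_K,x_S)\in\mathcal{N}(Sp)$ if and only if $(I-J)x_K=Rx_S$ and $R^tx_K=0$. (2) $\{(0,z)^t: z\in\mathcal{N}(R)\}\subseteq\mathcal{N}(Sp)$; equality holds if and only if $\operatorname{Supp}(Sp)\subseteq S$. (3) $\operatorname{nl}(Sp)\ge\operatorname{nl}(R)=|S|-\operatorname{rk}(R)$; equality $\operatorname{nl}(Sp)=\operatorname{nl}(R)$ holds if and only if $\operatorname{Supp}(Sp)\subseteq S$. (4) If $(x_K,x_S)\in\mathcal{N}(Sp)$ and $\mathbf{1}^tx_K=0$, then $x_K=0$. (5) If $\mathbf{1}\in\operatorname{im}(R)$, then $\operatorname{Supp}(Sp)\subseteq S$.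
   Context: Graphs are finite and simple. A split graph is a graph $Sp$ whose vertex set is a disjoint union of a clique $K$ and an independent set $S$; the pair $(K,S)$ is called an s-partition, and $Sp(K,S)$ denotes $Sp$ together with this s-partition. Both $K$ and $S$ are assumed nonempty. With the vertices ordered as $(K,S)$, the adjacency matrix is \[A(Sp)=\begin{pmatrix} J-I & R\\ R^t & 0\end{pmatrix},\] where $J$ is an all-ones matrix, $I$ the identity, and $R$ is the $|K|\times|S|$ $0/1$ biadjacency matrix ($R_{uv}=1$ iff $u\in K$ and $v\in S$ are adjacent). Vectors indexed by $V(Sp)$ are written $(x_K,x_S)$ with $x_K\in\mathbb{R}^{|K|}$, $x_S\in\mathbb{R}^{|S|}$. All matrices are real; $\mathcal{N}(A)$, $\operatorname{nl}(A)$, $\operatorname{rk}(A)$, $\operatorname{im}(A)$ are the nullspace, nullity, rank and column space of $A$; $\mathcal{N}(Sp)$ and $\operatorname{nl}(Sp)$ are those of $A(Sp)$. $\mathbf{1}$ is the all-ones column vector. $\operatorname{Supp}(Sp)$ is the set of vertices $v$ such that $x_v\ne 0$ for some $x\in\mathcal{N}(Sp)$. *)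

(* Defs.v *)
(* MathComp development; the scalars are an arbitrary [realType]. *)
From HB Require Import structures.
From mathcomp Require Import all_boot all_order all_algebra.
From mathcomp Require Import boolp classical_sets reals.

Set Implicit Arguments.
Unset Strict Implicit.
Unset Printing Implicit Defensive.

Import GRing.Theory Num.Theory.
Local Open Scope ring_scope.

Record simple_graph := SimpleGraph {
  vertex :> finType;
  edge : rel vertex;
  edge_sym : symmetric edge;
  edge_irrefl : irreflexive edge
}.

Arguments edge {s}.

Section SplitGraph.

Variables (G : simple_graph) (K S : {set G}).

Definition clique (A : {set G}) : Prop :=
  {in A &, forall u v, u != v -> edge u v}.

Definition independent (A : {set G}) : Prop :=
  {in A &, forall u v, ~~ edge u v}.

Record s_partition : Prop := SPartition {
  s_partition_cover : K :|: S = [set: G]%SET;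
  s_partition_disjoint : [disjoint K & S];
  s_partition_clique : clique K;
  s_partition_independent : independent S;
  s_partition_K_neq0 : K != finset.set0;
  s_partition_S_neq0 : S != finset.set0
}.

(* The ordering (K, S) of the vertices: first those of K, then those of S.
   It is a bijection onto G under [s_partition] (see [ks_vertex_bij]). *)
Definition ks_vertex (i : 'I_(#|K| + #|S|)) : G :=
  match split i with
  | inl k => enum_val k
  | inr s => enum_val s
  end.

Lemma ks_vertex_bij : s_partition -> bijective ks_vertex.
Proof.
case=> cKS dKS _ _ _ _.
have cardG : #|G| = (#|K| + #|S|)%N.
  by rewrite -cardsUI cKS cardsT (disjoint_setI0 dKS) cards0 addn0.
apply: inj_card_bij; last by rewrite card_ord cardG.
have KS (k : 'I_#|K|) (s : 'I_#|S|) : enum_val k <> enum_val s.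
  by move=> ks; move: (enum_valP s); rewrite -ks (disjointFr dKS (enum_valP k)).
move=> i j; rewrite /ks_vertex => eij; apply: (can_inj splitK); move: eij.
case: (split i) (split j) => [k|s] [k'|s'].
- by move/enum_val_inj->.
- by move/KS.
- by move/esym/KS.
- by move/enum_val_inj->.
Qed.

Variable R : realType.

Definition adjacency_mx : 'M[R]_(#|K| + #|S|) :=
  \matrix_(i, j) (edge (ks_vertex i) (ks_vertex j))%:R.

Definition biadjacency_mx : 'M[R]_(#|K|, #|S|) :=
  \matrix_(i, j) (edge (enum_val i) (enum_val j))%:R.

Lemma adjacency_mxE : s_partition ->
  adjacency_mx = block_mx (const_mx 1 - 1%:M) biadjacency_mx
                          biadjacency_mx^T    0.
Proof.
case=> _ _ cK iS _ _; apply/matrixP => i j.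
rewrite -[i]splitK -[j]splitK.
case: (split i) => [k|s]; case: (split j) => [k'|s'] /=;
  rewrite ?(block_mxEul, block_mxEur, block_mxEdl, block_mxEdr) !mxE
    /ks_vertex ?(unsplitK (inl _)) ?(unsplitK (inr _)) //.
- have [->|kk'] := eqVneq k k'; first by rewrite edge_irrefl subrr.
  by rewrite cK ?enum_valP ?(inj_eq enum_val_inj) // subr0.
- by rewrite edge_sym.
- by rewrite (negPf (iS _ _ (enum_valP _) (enum_valP _))).
Qed.

End SplitGraph.

Section MatrixSpaces.

Variables (R : realType) (m n : nat) (A : 'M[R]_(m, n)).

(* MathComp's [kermx] and row spaces refer to row vectors; the nullspace
   {x | A x = 0} and the column space {A x} live in column vectors. *)
Definition nullspace : {vspace 'cV[R]_n} :=
  lker (linfun (mulmx A : 'cV[R]_n -> 'cV[R]_m)).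

Definition colspace : {vspace 'cV[R]_m} :=
  limg (linfun (mulmx A : 'cV[R]_n -> 'cV[R]_m)).

Definition nullity : nat := \dim nullspace.

Lemma mem_nullspace (x : 'cV[R]_n) : (x \in nullspace) = (A *m x == 0).
Proof. by rewrite memv_ker lfunE. Qed.

Lemma mem_colspaceP (y : 'cV[R]_m) :
  reflect (exists x : 'cV[R]_n, y = A *m x) (y \in colspace).
Proof.
apply: (iffP memv_imgP) => [[x _ ->]|[x ->]]; first by exists x; rewrite lfunE.
by exists x; rewrite ?memvf ?lfunE.
Qed.

End MatrixSpaces.

(* The entry x_v is the coordinate of x at the position of v in the ordering. *)
Definition Supp (R : realType) (G : simple_graph) (K S : {set G}) : set G :=
  [set v | exists2 x : 'cV[R]_(#|K| + #|S|),
             x \in nullspace (adjacency_mx K S R)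
           & exists2 i, ks_vertex i = v & x i 0 != 0]%classic.

(* Main.v *)
(* Pair the two equations of (1): if [1^T xK = 0] then [xK = R xS], so that
   [xK^T xK = (R^T xK)^T xS = 0], which is (4).  If [1 = R y] then
   [1^T xK = y^T (R^T xK) = 0], so (5) follows from (4).  The inclusion of the
   support in [S] says that every null vector has the form [(0, z)], and (3)
   compares dimensions in (2). *)
Require Import Defs.
From HB Require Import structures.
From mathcomp Require Import all_boot all_order all_algebra.
From mathcomp Require Import boolp classical_sets reals.

Set Implicit Arguments.
Unset Strict Implicit.
Unset Printing Implicit Defensive.

Import GRing.Theory Num.Theory.
Local Open Scope ring_scope.

Lemma cV_sqr_eq0 (F : realDomainType) n (x : 'cV[F]_n) : x^T *m x = 0 -> x = 0.
Proof.
move=> /matrixP/(_ 0 0); rewrite !mxE => /eqP.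
rewrite psumr_eq0 => [/allP x0|i _]; last by rewrite mxE -expr2 sqr_ge0.
apply/colP => i; rewrite mxE; have /(_ (mem_index_enum i)) := x0 i.
by rewrite mxE mulf_eq0 orbb => /eqP.
Qed.

(** Full-rank factorization: [A = col_base A *m row_base A]. The right factor has a right inverse,
    so it does not shrink the column space; the left factor has a left inverse, so it is injective
    on a space of dimension [\rank A]. *)
Lemma dim_colspace (F : realType) m n (A : 'M[F]_(m, n)) :
  \dim (colspace A) = \rank A.
Proof.
have -> : colspace A = colspace (col_base A).
  apply/vspaceP => y; apply/mem_colspaceP/mem_colspaceP => -[x ->].
    by exists (row_base A *m x); rewrite mulmxA mulmx_base.
  (* This preimage works because [pinvmx (row_base A)] is a right inverse of the row-free
     [row_base A]. *)
  exists (pinvmx (row_base A) *m x).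
  rewrite -{1}(mul1mx x) -(mulmxVp (row_base_free A)).
  by rewrite -(mulmxA (row_base A)) (mulmxA (col_base A)) mulmx_base.
rewrite /colspace limg_dim_eq ?dimvf ?/dim /= ?muln1 // capfv.
apply/eqP; rewrite -subv0; apply/subvP => x.
rewrite memv_ker lfunE memv0 /= => /eqP x0.
by rewrite -(mul1mx x) -(mulVpmx (col_base_full A)) -mulmxA x0 mulmx0.
Qed.

Lemma nullityE (F : realType) m n (A : 'M[F]_(m, n)) :
  nullity A = (n - \rank A)%N.
Proof.
(* The dimension of ['cV_n] unfolds to [n * 1]; [n] is put in that form so that rank-nullity for
   [linfun] applies. *)
rewrite -dim_colspace /nullity -[X in (X - _)%N](muln1 n).
rewrite -[X in (X - _)%N](dimvf 'cV[F]_n).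
by rewrite -(limg_ker_dim (linfun (mulmx A : 'cV_n -> 'cV_m)) fullv) capfv addnK.
Qed.

Section SplitGraphNullspace.

Variables (F : realType) (G : simple_graph) (K S : {set G}).
Hypothesis KS : s_partition K S.

Let A := adjacency_mx K S F.
Let R := biadjacency_mx K S F.

Lemma mem_nullspace_adjacency (xK : 'cV[F]_#|K|) (xS : 'cV[F]_#|S|) :
  col_mx xK xS \in nullspace A <->
  (1%:M - const_mx 1) *m xK = R *m xS /\ R^T *m xK = 0.
Proof.
rewrite mem_nullspace /A adjacency_mxE // mul_block_col mul0mx addr0 -/R.
rewrite col_mx_eq0 -opprB mulNmx addrC subr_eq0.
split=> [/andP[/eqP-> /eqP->] //|[-> ->]].
by rewrite !eqxx.
Qed.

Lemma nullspace_sum_eq0 (xK : 'cV[F]_#|K|) (xS : 'cV[F]_#|S|) :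
  col_mx xK xS \in nullspace A ->
  (const_mx 1 : 'rV[F]_#|K|) *m xK = 0 -> xK = 0.
Proof.
move=> /mem_nullspace_adjacency[xKS RxK] sum0; apply: cV_sqr_eq0.
have J0 : (const_mx 1 : 'M[F]_#|K|) *m xK = 0.
  apply/matrixP => i j; move/matrixP/(_ 0 j): sum0; rewrite !mxE => sum0.
  by rewrite -[RHS]sum0; apply: eq_bigr => k _; rewrite !mxE.
(* Only the untransposed factor of [xK^T *m xK] becomes [R *m xS]; the transposed one is kept to
   meet [R^T *m xK = 0]. *)
move: xKS; rewrite mulmxBl mul1mx J0 subr0 => {2}->.
by rewrite mulmxA -[R]trmxK -trmx_mul RxK trmx0 mul0mx.
Qed.

(** Turns a condition on vertices into one on vectors: as [K] and [S] are disjoint, a nonzero entry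
    of [xK] would put a vertex outside [S] into the support. *)
Lemma Supp_subsetP :
  (Supp F K S `<=` [set` S])%classic <->
  forall (xK : 'cV[F]_#|K|) (xS : 'cV[F]_#|S|),
    col_mx xK xS \in nullspace A -> xK = 0.
Proof.
split=> [sub xK xS xA|xK0 v [x xA [i <- {v}]] /=].
  apply/colP => k; rewrite [RHS]mxE; apply/eqP/contraT => xk.
  have : enum_val k \in S.
    apply: sub; exists (col_mx xK xS) => //; exists (lshift #|S| k).
      by rewrite /ks_vertex (unsplitK (inl _)).
    by rewrite col_mxEu.
  by rewrite (disjointFr (s_partition_disjoint KS) (enum_valP k)).
rewrite -[x]vsubmxK in xA *; rewrite (xK0 _ _ xA) /ks_vertex mxE.
by case: (split i) => [k|s _]; rewrite ?mxE ?eqxx ?enum_valP.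
Qed.

(** Bundled as a linear map, so that the set in (2) is a subspace whose dimension can be used in
    (3). *)
Definition null_embedding : 'Hom('cV[F]_#|S|, 'cV[F]_(#|K| + #|S|)) :=
  linfun (mulmx (col_mx 0 1%:M)).

Lemma null_embeddingE (z : 'cV[F]_#|S|) : null_embedding z = col_mx 0 z.
Proof. by rewrite lfunE /= mul_col_mx mul0mx mul1mx. Qed.

Lemma null_embedding_set :
  [set col_mx (0 : 'cV[F]_#|K|) z | z in [set` nullspace R]]%classic =
  [set` (null_embedding @: nullspace R)%VS]%classic.
Proof.
apply/seteqP; split=> [_ [z zR <-]|x /memv_imgP[z zR ->]] /=.
  by rewrite -null_embeddingE memv_img.
by exists z => //; rewrite null_embeddingE.
Qed.

Lemma null_embedding_sub : (null_embedding @: nullspace R <= nullspace A)%VS.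
Proof.
apply/subvP => _ /memv_imgP[z zR ->]; rewrite null_embeddingE.
apply/mem_nullspace_adjacency; rewrite !mulmx0; split=> //.
by apply/esym/eqP; rewrite -mem_nullspace.
Qed.

Lemma null_embedding_dim : \dim (null_embedding @: nullspace R) = nullity R.
Proof.
apply: limg_dim_eq; apply/eqP; rewrite -subv0; apply/subvP => z.
rewrite memv_cap memv_ker null_embeddingE col_mx_eq0 memv0.
by case/and3P.
Qed.

Lemma null_embedding_eqP :
  (null_embedding @: nullspace R)%VS = nullspace A <->
  (Supp F K S `<=` [set` S])%classic.
Proof.
rewrite Supp_subsetP; split=> [<- xK xS|xK0].
  by case/memv_imgP=> z _; rewrite null_embeddingE => /eq_col_mx[].
apply/eqP; rewrite eqEsubv null_embedding_sub; apply/subvP => x.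
rewrite -[x]vsubmxK => xA; have xK := xK0 _ _ xA; rewrite xK in xA *.
rewrite -null_embeddingE memv_img // mem_nullspace.
(* Once [xK = 0], the first equation of (1) reduces to [R *m xS = 0]. *)
by have [<- _] := (mem_nullspace_adjacency _ _).1 xA; rewrite mulmx0.
Qed.

End SplitGraphNullspace.

Local Open Scope classical_set_scope.

Theorem theorem3p2 (F : realType) (G : simple_graph) (K S : {set G}) :
  s_partition K S ->
  let A := adjacency_mx K S F in
  let R := biadjacency_mx K S F in
  [/\ (* (1) *)
      forall (xK : 'cV[F]_#|K|) (xS : 'cV[F]_#|S|),
        col_mx xK xS \in nullspace A <->
        (1%:M - const_mx 1) *m xK = R *m xS /\ R^T *m xK = 0,
      (* (2) *)
      [set col_mx (0 : 'cV[F]_#|K|) z | z in [set` nullspace R]]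
        `<=` [set` nullspace A] /\
      ([set col_mx (0 : 'cV[F]_#|K|) z | z in [set` nullspace R]]
        = [set` nullspace A] <-> Supp F K S `<=` [set` S]),
      (* (3) *)
      [/\ (nullity R <= nullity A)%N,
          nullity R = (#|S| - \rank R)%N &
          nullity A = nullity R <-> Supp F K S `<=` [set` S]],
      (* (4) *)
      forall (xK : 'cV[F]_#|K|) (xS : 'cV[F]_#|S|),
        col_mx xK xS \in nullspace A ->
        (const_mx 1 : 'rV[F]_#|K|) *m xK = 0 -> xK = 0 &
      (* (5) *)
      (const_mx 1 : 'cV[F]_#|K|) \in colspace R -> Supp F K S `<=` [set` S]].
Proof.
move=> KS; cbv zeta; split.
- exact: mem_nullspace_adjacency.
- rewrite null_embedding_set; split.
    by move=> x /=; apply/subvP/null_embedding_sub.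
  rewrite -null_embedding_eqP //; split=> [/seteqP[_ sub]|-> //].
  by apply/eqP; rewrite eqEsubv null_embedding_sub //; apply/subvP/sub.
(* The embedding is injective, so [nullity R] is the dimension of a subspace of [nullspace A]; equal
   dimensions then force equal subspaces. *)
- rewrite -(null_embedding_dim F K S); split.
  + exact/dimvS/null_embedding_sub.
  + by rewrite null_embedding_dim nullityE.
  + rewrite -null_embedding_eqP //; split=> [dimA|-> //].
    by apply/eqP; rewrite eqEdim null_embedding_sub // -dimA leqnn.
- exact: nullspace_sum_eq0.
- move=> /mem_colspaceP[y Ry]; apply/Supp_subsetP => // xK xS xA.
  apply: (nullspace_sum_eq0 KS xA).
  have [_ RxK] := (mem_nullspace_adjacency KS _ _).1 xA.
  by rewrite -trmx_const Ry trmx_mul -mulmxA RxK mulmx0.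
Qed.
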